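(* Let $R$ be a rack. Then the following statements are equivalent: (1) $\mathcal{R}(R)$ is a Boolean algebra; (2) $\mathcal{R}(R)$ is distributive; (3) $\mathcal{R}(R)$ is pseudocomplemented; (4) $\mathcal{R}(R)$ is uniquely complemented.
   Context: A rack is a set $R$ with a binary operation $\triangleright$ such that $a\triangleright(b\triangleright c)=(a\triangleright b)\triangleright(a\triangleright c)$ for all $a,b,c\in R$, and for all $a,b\in R$ there is a unique $x\in R$ with $a\triangleright x=b$. A subrack is a subset $Q$ with $(Q,\triangleright)$ a rack (including $\emptyset$); $\ll S\gg$ is the intersection of all subracks containing $S$. $\mathcal{R}(R)$ is the lattice of subracks ordered by inclusion, with meet the intersection, join $\ll Q\cup Q'\gg$, bottom $\emptyset$ and top $R$. A Boolean algebra is a complemented distributive lattice. A lattice with least element $\hat 0$ is pseudocomplemented if for every $x$ there is a greatest element $x^*$ with $x\wedge x^*=\hat 0$. A lattice is uniquely complemented if it is complemented and every element has exactly one complement. *)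

(* Defs.v *)
From HB Require Import structures.
From mathcomp Require Import all_boot all_order.
From mathcomp Require Import boolp classical_sets.

Set Implicit Arguments.
Unset Strict Implicit.
Unset Printing Implicit Defensive.

Import Order.TTheory.

Reserved Notation "a |> b" (at level 45, no associativity).

HB.mixin Record isRack (R : Type) := {
  rack_op : R -> R -> R;
  rack_selfdistr : forall a b c,
    rack_op a (rack_op b c) = rack_op (rack_op a b) (rack_op a c);
  rack_division : forall a b, exists! x, rack_op a x = b
}.

#[short(type="rackType")]
HB.structure Definition Rack := {R of isRack R}.

Declare Scope rack_scope.
Delimit Scope rack_scope with rack.
Notation "a |> b" := (rack_op a b) : rack_scope.
Local Open Scope rack_scope.
Local Open Scope classical_set_scope.

(* [Q] is a rack for the restriction of the operation; in particular the
   solution of [a |> x = b] must exist inside [Q], which need not follow from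
   closure under [|>] when [Q] is infinite. *)
Definition subrack (R : rackType) (Q : set R) : Prop :=
  [/\ forall a b, Q a -> Q b -> Q (a |> b),
      forall a b c, Q a -> Q b -> Q c ->
        a |> (b |> c) = (a |> b) |> (a |> c)
    & forall a b, Q a -> Q b -> exists! x, Q x /\ a |> x = b].

Definition subrack_gen (R : rackType) (S : set R) : set R :=
  smallest (@subrack R) S.

Lemma subrackP (R : rackType) (Q : set R) :
  subrack Q <->
  (forall a b, Q a -> Q b -> Q (a |> b)) /\
  (forall a x, Q a -> Q (a |> x) -> Q x).
Proof.
split=> [[Qop _ Qdiv]|[Qop Qdiv]].
- split=> // a x Qa Qax.
  have [y [[Qy ayE] _]] := Qdiv _ _ Qa Qax.
  have [z [_ zU]] := rack_division a (a |> x).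
  by rewrite -(zU x erefl) (zU y ayE).
- split=> // [a b c _ _ _|a b Qa Qb]; first exact: rack_selfdistr.
  have [x [axE xU]] := rack_division a b.
  exists x; split=> [|y [_ ayE]]; last exact: xU.
  by split=> //; apply: Qdiv Qa _; rewrite axE.
Qed.

Lemma subrack_set0 (R : rackType) : subrack (@set0 R).
Proof. by apply/subrackP; split. Qed.

Lemma subrack_setT (R : rackType) : subrack (@setT R).
Proof. by apply/subrackP; split. Qed.

Lemma subrack_bigcap (R : rackType) (F : set (set R)) :
  F `<=` @subrack R -> subrack (\bigcap_(Q in F) Q).
Proof.
move=> Fsub; apply/subrackP; split=> [a b Fa Fb Q FQ|a x Fa Fax Q FQ];
  have /subrackP[Qop Qdiv] := Fsub Q FQ.
- by apply: Qop; [exact: Fa|exact: Fb].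
- by apply: (Qdiv a); [exact: Fa|exact: Fax].
Qed.

Lemma subrackI (R : rackType) (P Q : set R) :
  subrack P -> subrack Q -> subrack (P `&` Q).
Proof.
move=> /subrackP[Pop Pdiv] /subrackP[Qop Qdiv]; apply/subrackP.
split=> [a b [Pa Qa] [Pb Qb]|a x [Pa Qa] [Pax Qax]].
- by split; [exact: Pop|exact: Qop].
- by split; [exact: Pdiv Pa Pax|exact: Qdiv Qa Qax].
Qed.

Lemma subrack_gen_subrack (R : rackType) (S : set R) : subrack (subrack_gen S).
Proof. by apply: subrack_bigcap => Q []. Qed.

Record subrack_lattice (R : rackType) := Subrack {
  subrack_set :> set R;
  _ : `[< subrack subrack_set >]
}.

HB.instance Definition _ (R : rackType) :=
  [isSub for @subrack_set R].
HB.instance Definition _ (R : rackType) :=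
  [Choice of subrack_lattice R by <:].

Fact subrack_display : Order.disp_t. Proof. exact: Order.Disp tt tt. Qed.

HB.instance Definition _ (R : rackType) :=
  [SubChoice_isSubPOrder of subrack_lattice R by <: with subrack_display].

Section SubrackLattice.
Variable R : rackType.
Local Notation L := (subrack_lattice R).

Definition mk_subrack (Q : set R) (subQ : subrack Q) : L :=
  Subrack (asboolT subQ).

Lemma subrack_val (P : L) : subrack P.
Proof. by case: P => Q /= /asboolP. Qed.

Definition subrack_meet (P Q : L) : L :=
  mk_subrack (subrackI (subrack_val P) (subrack_val Q)).

Definition subrack_join (P Q : L) : L :=
  mk_subrack (subrack_gen_subrack (P `|` Q)).

Definition subrack_bot : L := mk_subrack (@subrack_set0 R).

Definition subrack_top : L := mk_subrack (@subrack_setT R).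

Lemma subrack_leP (P Q : L) : reflect (P `<=` Q) (P <= Q)%O.
Proof. exact: subsetPset. Qed.

Lemma subrack_meetP (P Q S : L) :
  (P <= subrack_meet Q S)%O = (P <= Q)%O && (P <= S)%O.
Proof.
apply/subrack_leP/andP => [PQS|[/subrack_leP PQ /subrack_leP PS]].
- by split; apply/subrack_leP => x /PQS[].
- by move=> x Px; split; [exact: PQ|exact: PS].
Qed.

Lemma subrack_joinP (P Q S : L) :
  (subrack_join P Q <= S)%O = (P <= S)%O && (Q <= S)%O.
Proof.
apply/subrack_leP/andP => [PQS|[/subrack_leP PS /subrack_leP QS]].
- by split; apply/subrack_leP => x ?; apply: PQS => T [_]; apply; [left|right].
- move=> x; apply; split; first exact: subrack_val.
  by rewrite subUset; split.
Qed.

HB.instance Definition _ := Order.POrder_MeetJoin_isLattice.Build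
  subrack_display L subrack_meetP subrack_joinP.

Lemma subrack_le0 (P : L) : (subrack_bot <= P)%O.
Proof. exact/subrack_leP. Qed.

Lemma subrack_leT (P : L) : (P <= subrack_top)%O.
Proof. exact/subrack_leP. Qed.

HB.instance Definition _ :=
  Order.hasBottom.Build subrack_display L subrack_le0.
HB.instance Definition _ :=
  Order.hasTop.Build subrack_display L subrack_leT.

End SubrackLattice.

Section LatticeProperties.
Local Open Scope order_scope.

Definition is_complement d (L : tbLatticeType d) (x y : L) : Prop :=
  x `&` y = \bot /\ x `|` y = \top.

Definition complemented d (L : tbLatticeType d) : Prop :=
  forall x : L, exists y : L, is_complement x y.

Definition distributive d (L : latticeType d) : Prop :=
  forall x y z : L, x `&` (y `|` z) = (x `&` y) `|` (x `&` z).

Definition boolean_algebra d (L : tbLatticeType d) : Prop :=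
  complemented L /\ distributive L.

Definition pseudocomplemented d (L : bLatticeType d) : Prop :=
  forall x : L, exists xs : L,
    x `&` xs = \bot /\ forall y : L, x `&` y = \bot -> y <= xs.

Definition uniquely_complemented d (L : tbLatticeType d) : Prop :=
  complemented L /\ forall x : L, exists! y : L, is_complement x y.

End LatticeProperties.

Arguments complemented {d} L.
Arguments distributive {d} L.
Arguments boolean_algebra {d} L.
Arguments pseudocomplemented {d} L.
Arguments uniquely_complemented {d} L.

(* Main.v *)
(** In a rack, the subracks generated by single elements partition [R]: they are
    the atoms of the lattice, and every subrack is a union of atoms.  Each of the
    four properties amounts to the complement of every atom being a subrack:
    every union of atoms is then an intersection of such complements, hence a
    subrack, and the lattice is the power set of the set of atoms.  Under (4),
    the complement [p'] of an atom [p] is a coatom, and an atom [q] not below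
    [p'] would be, like [p], a complement of [p'], so [p'] is the set-theoretic
    complement of [p]. *)
Require Import Defs.
From mathcomp Require Import all_boot all_order.
From mathcomp Require Import boolp classical_sets.

Set Implicit Arguments.
Unset Strict Implicit.
Unset Printing Implicit Defensive.

Import Order.TTheory.
Local Open Scope classical_set_scope.
Local Open Scope rack_scope.

Section Atoms.
Variable R : rackType.
Local Notation L := (subrack_lattice R).
Implicit Types (a b x y : R) (Q S : set R).

Lemma rack_opI a : injective (rack_op a).
Proof.
move=> x y axy; have [z [_ zU]] := rack_division a (a |> y).
by rewrite -(zU x axy) (zU y erefl).
Qed.

(** Every [x] has the form [a |> y], and self-distributivity folds the left side into
    [a |> (a |> y)]. *)
Lemma rack_op_sq a x : (a |> a) |> x = a |> x.
Proof. by have [y [<- _]] := rack_division a x; rewrite -rack_selfdistr. Qed.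

Lemma subrack_gen_min S Q : subrack Q -> S `<=` Q -> subrack_gen S `<=` Q.
Proof. by move=> subQ SQ x; apply. Qed.

Lemma sub_subrack_gen S : S `<=` subrack_gen S.
Proof. by move=> x Sx Q [_]; apply. Qed.

Lemma subrack_gen1_min a Q : subrack Q -> Q a -> subrack_gen [set a] `<=` Q.
Proof. by move=> subQ Qa; apply: subrack_gen_min => // _ ->. Qed.

Lemma subrack_gen1_refl a : subrack_gen [set a] a.
Proof. exact: sub_subrack_gen. Qed.

Lemma subrack_gen1_sym a x :
  subrack_gen [set a] x -> subrack_gen [set x] a.
Proof.
(* Elements acting like [a] satisfy [y |> z = z |> z], so the operation of [T]
   depends on one element only and never leaves the subrack it generates. *)
pose T := [set y | (forall z, y |> z = a |> z) /\ subrack_gen [set y] a].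
suff subT : subrack T.
  by move=> /(_ T)[]//; split=> // _ ->; split=> //; exact: subrack_gen1_refl.
apply/subrackP; split=> [y z [yE _] [zE za]|y z [yE _]].
- have -> : y |> z = z |> z by rewrite yE zE.
  split=> [t|]; first by rewrite rack_op_sq.
  (* Since [(z |> z) |> z = z |> z], division puts [z] in the subrack generated by [z |> z]. *)
  apply: subrack_gen1_min za; first exact: subrack_gen_subrack.
  have /subrackP[_] := subrack_gen_subrack [set z |> z].
  apply; first exact: subrack_gen1_refl.
  by rewrite rack_op_sq; exact: subrack_gen1_refl.
- rewrite yE => -[azE aza].
  (* As [a |> z] acts like [a], applying [a] to either side yields [a |> (a |> t)]. *)
  have zE t : z |> t = a |> t.
    by apply: (@rack_opI a); rewrite rack_selfdistr azE.
  split=> //; move: aza; rewrite -zE.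
  apply: subrack_gen1_min; first exact: subrack_gen_subrack.
  have /subrackP[zop _] := subrack_gen_subrack [set z].
  by apply: zop; exact: subrack_gen1_refl.
Qed.

(** By symmetry [x] generates a subrack containing [a]; this makes the subracks generated by one
    element minimal among the nonempty ones. *)
Lemma subrack_mem_gen1 Q a x :
  subrack Q -> subrack_gen [set a] x -> Q x -> Q a.
Proof. by move=> subQ /subrack_gen1_sym xa Qx; exact: subrack_gen1_min xa. Qed.

Definition atom a : L := mk_subrack (subrack_gen_subrack [set a]).

Lemma subrack_eqP (P Q : L) : P = Q <-> P `<=>` Q.
Proof.
split=> [->|[PQ QP]]; first by split.
by apply/le_anti/andP; split; exact/subrack_leP.
Qed.

Lemma subrack_meet_eq0 (P Q : L) :
  (P `&` Q)%O = \bot%O <-> forall x, subrack_set P x -> ~ subrack_set Q x.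
Proof.
split=> [PQ0 x Px Qx|PQ0].
  by have /subrack_eqP[/(_ x (conj Px Qx))] := PQ0.
by apply/subrack_eqP; split=> // x [/PQ0].
Qed.

Lemma atom_meet_eq0 a (Q : L) : ~ subrack_set Q a -> (Q `&` atom a)%O = \bot%O.
Proof.
move=> Qa; apply/subrack_meet_eq0 => y Qy ay.
exact/Qa/(subrack_mem_gen1 (subrack_val Q) ay).
Qed.

Lemma subrack_joinl (P Q : L) : P `<=` (P `|` Q)%O.
Proof. exact/subrack_leP/leUl. Qed.

Lemma subrack_joinr (P Q : L) : Q `<=` (P `|` Q)%O.
Proof. exact/subrack_leP/leUr. Qed.

Definition co_atomic := forall a, subrack (~` subrack_gen [set a]).

Lemma union_of_atoms_subrack S : co_atomic ->
  (forall a, S a -> subrack_gen [set a] `<=` S) -> subrack S.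
Proof.
move=> coR satS.
have -> : S = \bigcap_(Q in [set ~` subrack_gen [set b] | b in ~` S]) Q.
  apply/seteqP; split=> [x Sx _ [b Sb <-] /subrack_gen1_sym/(satS _ Sx)//|x Fx].
  apply: contrapT => Sx; apply: (Fx (~` subrack_gen [set x])); first by exists x.
  exact: subrack_gen1_refl.
by apply: subrack_bigcap => _ [b _ <-]; exact: coR.
Qed.

Lemma subrackC Q : co_atomic -> subrack Q -> subrack (~` Q).
Proof.
move=> coR subQ; apply: union_of_atoms_subrack => // a Qa x ax Qx.
exact/Qa/(subrack_mem_gen1 subQ ax).
Qed.

(** The set union is again a union of atoms, hence a subrack, and the join is no larger. *)
Lemma subrack_join_setU (P Q : L) : co_atomic -> (P `|` Q)%O `<=` P `|` Q.
Proof.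
move=> coR; apply: subrack_gen_min => //.
apply: union_of_atoms_subrack => // a [Pa|Qa].
- exact/(subset_trans (subrack_gen1_min (subrack_val P) Pa))/subsetUl.
- exact/(subset_trans (subrack_gen1_min (subrack_val Q) Qa))/subsetUr.
Qed.

Lemma co_atomic_complement (coR : co_atomic) (P : L) :
  is_complement P (mk_subrack (subrackC coR (subrack_val P))).
Proof.
split; first by apply/subrack_meet_eq0 => x Px; apply.
apply/subrack_eqP; split=> // x _.
have [Px|Px] := pselect (subrack_set P x); first exact: subrack_joinl.
exact: subrack_joinr.
Qed.

Lemma co_atomic_boolean : co_atomic -> boolean_algebra L.
Proof.
move=> coR; split=> [P|P Q S].
  exists (mk_subrack (subrackC coR (subrack_val P))).
  exact: co_atomic_complement.
apply/subrack_eqP; split=> [x [Px /(subrack_join_setU coR)[Qx|Sx]]|].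
- exact: subrack_joinl.
- exact: subrack_joinr.
(* This inclusion holds in every lattice. *)
- by apply/subrack_leP; rewrite leUx !lexI !leIl /= !leIxr ?leUl ?leUr.
Qed.

Lemma co_atomic_pseudocomplemented : co_atomic -> pseudocomplemented L.
Proof.
move=> coR P; exists (mk_subrack (subrackC coR (subrack_val P))).
split=> [|Q /subrack_meet_eq0 PQ0]; first exact: (co_atomic_complement coR P).1.
by apply/subrack_leP => x Qx Px; exact: PQ0 Px Qx.
Qed.

Lemma co_atomic_uniquely_complemented : co_atomic -> uniquely_complemented L.
Proof.
move=> coR; split=> [|P]; first exact: (co_atomic_boolean coR).1.
exists (mk_subrack (subrackC coR (subrack_val P))).
split=> [|Q [/subrack_meet_eq0 PQ0 /subrack_eqP[_ PQ1]]].
  exact: co_atomic_complement.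
apply/subrack_eqP; split=> [x Px|x Qx Px]; last exact: PQ0 Px Qx.
by have [] := subrack_join_setU coR (PQ1 x I).
Qed.

(** Distributivity makes the join of two atoms that miss [atom p] miss it as well. Products and
    quotients of [a] and [b] lie in the join of their atoms, so they stay outside [atom p]. *)
Lemma distributive_co_atomic : distributive L -> co_atomic.
Proof.
move=> distL p.
have key a b c : ~ subrack_gen [set p] a -> ~ subrack_gen [set p] b ->
    subrack_set (atom a `|` atom b)%O c -> ~ subrack_gen [set p] c.
  move=> pa pb abc pc.
  have /subrack_meet_eq0 : (atom p `&` (atom a `|` atom b))%O = \bot%O.
    by rewrite distL !atom_meet_eq0 ?joinxx.
  by move=> /(_ c pc).
have la a b : subrack_set (atom a `|` atom b)%O a.
  by apply: subrack_joinl; exact: subrack_gen1_refl.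
have lb a b : subrack_set (atom a `|` atom b)%O b.
  by apply: subrack_joinr; exact: subrack_gen1_refl.
apply/subrackP; split=> [a b pa pb|a x pa pax].
- apply: (key _ _ _ pa pb).
  by have /subrackP[abop _] := subrack_val (atom a `|` atom b)%O; exact: abop.
- apply: (key _ _ _ pa pax).
  have /subrackP[_ abdiv] := subrack_val (atom a `|` atom (a |> x))%O.
  exact: (abdiv a).
Qed.

(** Every atom disjoint from [atom p] lies below its pseudocomplement, which therefore contains all
    points outside [atom p]. *)
Lemma pseudocomplemented_co_atomic : pseudocomplemented L -> co_atomic.
Proof.
move=> pcL p; have [Q [/subrack_meet_eq0 pQ0 Qmax]] := pcL (atom p).
suff -> : ~` subrack_gen [set p] = Q by exact: subrack_val.
apply/seteqP; split=> [x px|x Qx px]; last exact: pQ0 px Qx.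
have /Qmax/subrack_leP := @atom_meet_eq0 x (atom p) px.
by apply; exact: subrack_gen1_refl.
Qed.

Lemma uniquely_complemented_co_atomic : uniquely_complemented L -> co_atomic.
Proof.
move=> [_ uL] p.
have [p' [[pp'0 pp'1] p'U]] := uL (atom p).
suff -> : ~` subrack_gen [set p] = p' by exact: subrack_val.
apply/seteqP; split=> [q pq|x p'x px]; last first.
  by have /subrack_meet_eq0/(_ x px) := pp'0.
apply: contrapT => p'q.
(* If this join contains [p], it lies above both [p'] and [atom p], so it is the top. Otherwise it
   is a complement of [atom p], hence equals [p'], although it contains [q]. *)
have p'q1 : (p' `|` atom q)%O = \top%O.
  apply: contrapT => p'q1; apply: (p'q).
  rewrite (p'U (p' `|` atom q)%O).
    by apply: subrack_joinr; exact: subrack_gen1_refl.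
  split; last by rewrite joinA pp'1 joinC joinx1.
  rewrite meetC; apply: atom_meet_eq0 => p'qp; apply: p'q1.
  apply/le_anti; rewrite lex1 -pp'1 leUx leUl andbT /=.
  by apply/subrack_leP; apply: subrack_gen1_min p'qp; exact: subrack_val.
(* Both [atom q] and [atom p] are complements of [p'], so uniqueness identifies them. *)
have [P [_ PU]] := uL p'.
have qp : atom q = atom p.
  rewrite -(PU (atom q)); last by split=> //; exact: atom_meet_eq0.
  by apply: PU; rewrite /is_complement meetC joinC.
apply: pq; change (subrack_set (atom p) q); rewrite -qp.
exact: subrack_gen1_refl.
Qed.

End Atoms.

Theorem theorem5p5 (R : rackType) :
  [<-> boolean_algebra (subrack_lattice R);
       distributive (subrack_lattice R);
       pseudocomplemented (subrack_lattice R);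
       uniquely_complemented (subrack_lattice R)].
Proof.
tfae.
- by case.
- by move=> /distributive_co_atomic/co_atomic_pseudocomplemented.
- by move=> /pseudocomplemented_co_atomic/co_atomic_uniquely_complemented.
- by move=> /uniquely_complemented_co_atomic/co_atomic_boolean.
Qed.
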